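(* Let $k\geq 2$ be an integer and let $\Delta\colon \mathbb{N}\to\mathbb{N}$ be an arbitrary coloring. Then there is an infinite set $X=\{x_1<x_2<\cdots\}\subseteq\mathbb{N}$ such that, writing $X_{sum}=X_{sum}(k)=\{\sum_{j\in J}x_j : J\in\binom{\mathbb{N}}{k}\}$, the sets $X$ and $X_{sum}$ are colored according to one of the following patterns: (i) $X\cup X_{sum}$ is monochromatic; or (ii) $X\cup X_{sum}$ is rainbow; or (iii) $X$ is rainbow and $\Delta(\sum_{j\in J}x_j)=\Delta(x_{\max J})$ for all $J\in\binom{\mathbb{N}}{k}$; or (iv) $X$ is rainbow and $\Delta(\sum_{j\in J}x_j)=\Delta(x_{\min J})$ for all $J\in\binom{\mathbb{N}}{k}$; or (v) $X$ is rainbow, $\Delta(X)\cap\Delta(X_{sum})=\emptyset$, and for all $I,J\in\binom{\mathbb{N}}{k}$: $\Delta(\sum_{j\in J}x_j)=\Delta(\sum_{j\in I}x_j)$ if and only if $\min I=\min J$ and $\max I=\max J$. Moreover, for $k=2$ patterns (ii) and (v) coincide, and none of the patterns may be omitted without violating the theorem: for each of the patterns there is a coloring $\Delta\colon\mathbb{N}\to\mathbb{N}$ such that no infinite set $X\subseteq\mathbb{N}$ satisfies any of the other patterns (for $k=2$, (ii) and (v) are regarded as one pattern).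
   Context: $\mathbb{N}$ denotes the set of positive integers. For a set $Y$, $\binom{Y}{k}$ is the set of all $k$-element subsets of $Y$. For a coloring $\Delta$ and a set $Y$, $\Delta(Y)=\{\Delta(y):y\in Y\}$. A set is monochromatic if all its elements receive the same color, and rainbow if all its elements receive pairwise distinct colors. The elements of $X$ are indexed increasingly as $x_1<x_2<\cdots$, and for $J\subseteq\mathbb{N}$ finite, $\sum_{j\in J}x_j$ refers to this indexing.
   Formalization: For k=2, (ii) and (v) do not literally coincide (Δ=id, X=ℕ satisfies (ii) but not (v)); it is proved instead that (v) holds iff (ii) holds, all pair sums are distinct and none lies in X, and that every X with (ii) contains an infinite Y with (v). *)

(* Defs.v *)
From mathcomp Require Import all_boot finmap.
From mathcomp Require Import boolp classical_sets functions cardinality.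

Set Implicit Arguments.
Unset Strict Implicit.
Unset Printing Implicit Defensive.

Local Open Scope nat_scope.
Local Open Scope fset_scope.
Local Open Scope classical_set_scope.

(* The positive integers, as a subset of nat.  A coloring of the positive     *)
(* integers by positive integers is a function on nat mapping this set to     *)
(* itself; its value at 0 plays no role.                                      *)
Definition positives : set nat := [set n | 0 < n].

Definition coloring (Delta : nat -> nat) : Prop :=
  forall n, positives n -> positives (Delta n).

Definition monochromatic (Delta : nat -> nat) (Y : set nat) : Prop :=
  forall a b, Y a -> Y b -> Delta a = Delta b.

Definition rainbow (Delta : nat -> nat) (Y : set nat) : Prop :=
  forall a b, Y a -> Y b -> a != b -> Delta a != Delta b.

(* Indices start at 0: x i is the element usually written x_(i+1).            *)
Definition enumerates (x : nat -> nat) (X : set nat) : Prop :=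
  (forall i j, i < j -> x i < x j) /\ X = range x.

Definition ksubsets (k : nat) : set {fset nat} := [set J | #|` J| = k].

Definition maxJ (J : {fset nat}) : nat := \max_(j <- J) j.

(* Starting the iterated minimum at maxJ J makes it the minimum of J for      *)
(* every nonempty J.                                                          *)
Definition minJ (J : {fset nat}) : nat := \big[minn/maxJ J]_(j <- J) j.

Definition sumJ (x : nat -> nat) (J : {fset nat}) : nat := \sum_(j <- J) x j.

Definition Xsum (k : nat) (x : nat -> nat) : set nat := sumJ x @` ksubsets k.

Inductive pattern : Set :=
  | Mono
  | Rainbow
  | MaxColored
  | MinColored
  | MinMax.

Definition follows_enum (Delta : nat -> nat) (k : nat) (p : pattern)
    (X : set nat) (x : nat -> nat) : Prop :=
  match p with
  | Mono => monochromatic Delta (X `|` Xsum k x)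
  | Rainbow => rainbow Delta (X `|` Xsum k x)
  | MaxColored =>
      rainbow Delta X /\
      forall J, ksubsets k J -> Delta (sumJ x J) = Delta (x (maxJ J))
  | MinColored =>
      rainbow Delta X /\
      forall J, ksubsets k J -> Delta (sumJ x J) = Delta (x (minJ J))
  | MinMax =>
      [/\ rainbow Delta X,
          (Delta @` X) `&` (Delta @` Xsum k x) = set0 &
          forall I J, ksubsets k I -> ksubsets k J ->
            (Delta (sumJ x J) = Delta (sumJ x I) <->
             minJ I = minJ J /\ maxJ I = maxJ J)]
  end.

(* An infinite set of natural numbers has exactly one increasing enumeration, *)
(* so the quantifier over x only names it.                                    *)
Definition follows (Delta : nat -> nat) (k : nat) (p : pattern)
    (X : set nat) : Prop :=
  exists2 x, enumerates x X & follows_enum Delta k p X x.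

Definition infinite_pos (X : set nat) : Prop :=
  infinite_set X /\ X `<=` positives.

(* Different k-subsets of indices have different sums and no such sum lies in *)
(* X.  In this case X `|` Xsum k x carries no accidental identifications.     *)
Definition distinct_sums (k : nat) (X : set nat) : Prop :=
  exists2 x, enumerates x X &
    (forall I J, ksubsets k I -> ksubsets k J -> sumJ x I = sumJ x J -> I = J)
    /\ X `&` Xsum k x = set0.

(* For k = 2 the patterns Rainbow and MinMax count as one pattern.            *)
Definition same_pattern (k : nat) (p q : pattern) : Prop :=
  p = q \/
  k = 2 /\ (p = Rainbow /\ q = MinMax \/ p = MinMax /\ q = Rainbow).

(* Main.v *)
Require Import Defs.
From mathcomp Require Import all_boot finmap.
From mathcomp Require Import boolp classical_sets functions cardinality filter.
From mathcomp Require Import zify.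

(* Some ultrafilter U on (nat, +) is idempotent: A belongs to U iff for       *)
(* U-most x and then U-most y, x + y belongs to A.  Write a ~ b for equality  *)
(* of colors, and a ~' b if a + z ~ b + z for U-most z; idempotence makes ~'  *)
(* stable under repeating this operation.  If one color class belongs to U we *)
(* get Mono; if x + y ~ y generically, MaxColored; if x + y ~ x generically,  *)
(* MinColored.  Otherwise, generically, a + z avoids every given color and    *)
(* every given ~'-class is U-small.  Comparing two finite sums of a generic   *)
(* sequence from their last terms backwards then yields MinMax if x + y ~' x  *)
(* generically and Rainbow if not.                                            *)
(*                                                                            *)
(* The patterns Mono, Rainbow, MaxColored, MinColored and MinMax are forced   *)
(* by the colors 1, n, floor(log2 n), the p-adic valuation of n for a prime p *)
(* dividing k, and the pair of the last two.  The condition p | k makes a sum *)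
(* of k congruent terms of equal valuation have a larger valuation, so that   *)
(* the valuation is never constant on X and X_sum together.                   *)

Set Implicit Arguments.
Unset Strict Implicit.
Unset Printing Implicit Defensive.

Local Open Scope nat_scope.
Local Open Scope classical_set_scope.

(** * An idempotent ultrafilter *)

(** [idempotent_ultrafilter] supplies U, and [generic_sequence] picks the terms one at a time, each
    meeting the finitely many U-large conditions that the sums of earlier terms impose. Which
    conditions are U-large depends on the case split in [canonical_pattern];
    [most_shift_nonconstant] and [most_shift_class] turn the failure of a case into conditions for
    the remaining ones.

    For k = 2 an index set is determined by its minimum and maximum, so Rainbow and MinMax differ
    only if two index pairs have the same sum or a sum lies in X; a sparse subsequence removes such
    coincidences ([sparse_distinct_sums]).

    For necessity, each special coloring is tested on an arbitrary increasing sequence. Among three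
    sums sharing a large last term, two have equal logarithms ([log_collision]); after thinning out,
    the p-adic valuation of a sum is either that of its first term or larger than the common
    valuation of all terms ([valuation_subsequence]). *)

Definition addf (F G : set_system nat) : set_system nat :=
  [set A | F [set x | G [set y | A (x + y)]]].

(** Inclusion, rather than equality, is what passes to unions of chains, so that Zorn's lemma
    applies. *)
Definition subidempotent (F : set_system nat) : Prop :=
  [/\ ProperFilter F, \oo `<=` F & F `<=` addf F F].

Lemma addfS (F F' G G' : set_system nat) : Filter F' ->
  F `<=` F' -> G `<=` G' -> addf F G `<=` addf F' G'.
Proof.
by move=> fF' FF' GG' A /FF'; apply: filterS => x; exact: GG'.
Qed.

Lemma addfA (F G H : set_system nat) : addf F (addf G H) = addf (addf F G) H.
Proof.
apply: funext => A; rewrite /addf /=.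
by under [in RHS]eq_fun => x do under eq_fun => y do under eq_fun => z do
  rewrite -addnA.
Qed.

Lemma addf_proper (F G : set_system nat) :
  ProperFilter F -> ProperFilter G -> ProperFilter (addf F G).
Proof.
move=> pF pG; split; last split.
- rewrite /addf /= => F0; apply: (filter_not_empty F).
  by apply: filterS F0 => x; exact: filter_not_empty.
- by rewrite /addf /=; apply: filterS filterT => x _; exact: filterT.
- rewrite /addf => P Q /= FP FQ; apply: filterS (filterI FP FQ) => x /= [GP GQ].
  exact: filterS (filterI GP GQ).
- rewrite /addf => P Q PQ /=; apply: filterS => x /=.
  by apply: filterS => y; exact: PQ.
Qed.

Lemma eventually_subidempotent : subidempotent \oo.
Proof.
split=> [|//|A [N _ NA]]; first exact: eventually_filter.
exists 0 => // x _; exists N => // y /= Ny; apply: NA => /=.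
exact: leq_trans Ny (leq_addl _ _).
Qed.

Lemma maximal_subidempotent : exists2 F, subidempotent F &
  forall G, subidempotent G -> F `<=` G -> G = F.
Proof.
have [C CP totC|F [[F0|sF] maxF]] :=
    @Zorn_bigcup _ [set F | F = set0 \/ subidempotent F].
- have [Cne|C0] := pselect (exists2 F, C F & subidempotent F); last first.
    left; rewrite -subset0 => A [F CF FA].
    by have [F0|sF] := CP _ CF; [rewrite F0 in FA|case: C0; exists F].
  have [F0 CF0 [[pF0 fF0] ooF0 _]] := Cne.
  have sub F A : C F -> F A -> subidempotent F.
    by move=> CF FA; have [F_0|//] := CP _ CF; rewrite F_0 in FA.
  right; split; last 2 first.
  + by move=> A ooA; exists F0 => //; exact: ooF0.
  + move=> A [F CF FA]; have [[pF fF] _ FFF] := sub _ _ CF FA.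
    have FA' : F [set x | F [set y | A (x + y)]] by exact: FFF.
    by exists F => //; apply: filterS FA' => x Fx; exists F.
  split; last split.
  + by move=> [F CF FA]; have [[] ] := sub _ _ CF FA.
  + by exists F0 => //; exact: filterT.
  + move=> P Q [F CF FP] [G CG GQ].
    have [[_ fF] _ _] := sub _ _ CF FP; have [[_ fG] _ _] := sub _ _ CG GQ.
    have [FG|GF] := totC _ _ CF CG.
      by exists G => //; apply: filterI => //; exact: FG.
    by exists F => //; apply: filterI => //; exact: GF.
  + move=> P Q PQ [F CF FP]; have [[_ fF] _ _] := sub _ _ CF FP.
    by exists F => //; exact: filterS FP.
- exfalso; apply: (maxF \oo); last by right; exact: eventually_subidempotent.
  by rewrite F0; split=> // /(_ setT filterT).
- exists F => // G sG FG; apply/seteqP; split=> //; apply: contrapT => nGF.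
  by apply: (maxF G); [split|right].
Qed.

(* Filter form of the Ellis-Numakura lemma: a maximal F contained in F + F    *)
(* equals F + u for every ultrafilter u above it, and the filter generated by *)
(* F and the sets {x | A - x is in u} for A in u is again contained in its    *)
(* own sum, which forces u = F.                                               *)
Lemma idempotent_ultrafilter : exists2 U : set_system nat, UltraFilter U &
  \oo `<=` U /\ addf U U = U.
Proof.
have [F [pF ooF FFF] maxF] := maximal_subidempotent.
have [u [uu Fu]] := ultraFilterLemma pF.
have pu : ProperFilter u by exact: ultra_proper.
have FuF : addf F u = F.
  apply: maxF.
    split; first exact: addf_proper.
      move=> A ooA; apply: addfS (FFF _ (ooF _ ooA)) => //.
    (* After reassociation it suffices that F lies in F + (u + F), and F is contained in F + (F +
       F). *)
    rewrite addfA -[addf (addf F u) F]addfA => A FuA.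
    apply: addfS FuA => //; first by do 2 apply: addf_proper.
    by apply: (subset_trans FFF); apply: addfS => //; apply: (subset_trans FFF);
      apply: addfS.
  by apply: (subset_trans FFF); exact: addfS.
pose H : set_system nat := [set C | exists B A, [/\ F B, u A &
  [set x | B x /\ u [set y | A (x + y)]] `<=` C]].
have FH : F `<=` H.
  by move=> B FB; exists B, setT; split=> [//||x []//]; exact: filterT.
have HF : H = F.
  apply: maxF => //; have fH : Filter H.
    split; first by apply: FH; exact: filterT.
      move=> P Q [B [A [FB uA BAP]]] [B' [A' [FB' uA' BAQ]]].
      exists (B `&` B'), (A `&` A'); split; [exact: filterI|exact: filterI|].
      move=> x [[Bx B'x] ux]; split; [apply: BAP|apply: BAQ]; split=> //;
        by apply: filterS ux => y [].
    by move=> P Q PQ [B [A [FB uA /subset_trans BAP]]]; exists B, A; split;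
      auto.
  split; last 2 first.
  - by move=> A ooA; apply/FH/ooF.
  - move=> C [B [A [FB uA BAC]]].
    have HB : addf H H B by apply: addfS (FFF _ FB).
    have HA : H [set x | u [set y | A (x + y)]].
      by exists setT, A; split=> //; [exact: filterT|move=> x []].
    rewrite /addf /= in HB *; apply: filterS (filterI HB HA) => x /= [HBx ux].
    have Hx : H [set y | u [set z | A (x + y + z)]].
      exists setT, [set y | A (x + y)]; split=> //; first exact: filterT.
      by move=> y [_ /=]; apply: filterS => z; rewrite /= addnA.
    by apply: filterS (filterI HBx Hx) => y [/= Bxy uxy]; apply: BAC.
  (* If H contained the empty set, then for every x in B the complement of A - x would be in u, so
     the complement of A would be in F + u = F, hence in u. *)
  split=> // -[B [A [FB uA BA0]]]; apply: (filter_not_empty u).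
  suff /Fu uA' : F (~` A) by apply: filterS (filterI uA uA') => x [].
  rewrite -FuF /addf /=; apply: filterS FB => x Bx.
  have [uAx|//] := in_ultra_setVsetC [set y | A (x + y)] uu.
  by case: (BA0 x).
have uF : u = F.
  apply/seteqP; split=> // A uA; rewrite -FuF /addf /= -HF.
  by exists setT, A; split=> //; [exact: filterT|move=> x []].
exists u => //; split; first by move=> A /ooF /Fu.
by rewrite {1}uF FuF.
Qed.

(** * Finite index sets *)

Lemma leq_maxJ (J : {fset nat}) j : j \in J -> j <= maxJ J.
Proof. by move=> jJ; rewrite /maxJ; exact: (leq_bigmax_seq (P := xpredT)). Qed.

Lemma maxJ_mem (J : {fset nat}) : J != fset0 -> maxJ J \in J.
Proof.
case/fset0Pn=> j jJ; have := leq_maxJ jJ; rewrite /maxJ big_seq.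
have [->|//] : \max_(i <- J | i \in J) i = 0 \/ \max_(i <- J | i \in J) i \in J.
  elim/big_rec: _ => [|i m iJ mJ]; first by left.
  right; case: mJ => [->|mJ]; first by rewrite maxn0.
  by case: (leqP i m).
by rewrite leqn0 => /eqP <-.
Qed.

Lemma maxJ_unique (J : {fset nat}) m :
  m \in J -> (forall j, j \in J -> j <= m) -> maxJ J = m.
Proof.
move=> mJ Jm; apply/eqP; rewrite eqn_leq leq_maxJ // Jm //.
by apply: maxJ_mem; apply/fset0Pn; exists m.
Qed.

Lemma minJ_mem (J : {fset nat}) : J != fset0 -> minJ J \in J.
Proof.
move=> J0; rewrite /minJ big_seq; elim/big_ind: _ => // [|i j iJ jJ].
  exact: maxJ_mem.
by case: (leqP i j).
Qed.

Lemma geq_minJ (J : {fset nat}) j : j \in J -> minJ J <= j.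
Proof.
rewrite /minJ; move: (maxJ J) => m.
have -> : (j \in J) = (j \in enum_fset J) by [].
elim: (enum_fset J) => // i s IHs; rewrite inE big_cons geq_min.
by case/predU1P => [->|/IHs ->]; rewrite ?leqnn ?orbT.
Qed.

Lemma minJ_unique (J : {fset nat}) m :
  m \in J -> (forall j, j \in J -> m <= j) -> minJ J = m.
Proof.
move=> mJ Jm; apply/eqP; rewrite eqn_leq geq_minJ // Jm //.
by apply: minJ_mem; apply/fset0Pn; exists m.
Qed.

Lemma sumJ0 x : sumJ x fset0 = 0.
Proof. by rewrite /sumJ big_seq_fset0. Qed.

Lemma sumJ1 x i : sumJ x [fset i]%fset = x i.
Proof. by rewrite /sumJ big_seq_fset1. Qed.

Lemma sumJU1 x n (I : {fset nat}) :
  n \notin I -> sumJ x (n |` I)%fset = sumJ x I + x n.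
Proof. by move=> nI; rewrite /sumJ big_fsetU1 //= addnC. Qed.

Lemma eq_sumJ x y (I : {fset nat}) :
  {in I, x =1 y} -> sumJ x I = sumJ y I.
Proof. by move=> xy; apply: eq_big_seq. Qed.

Lemma sumJ_gt0 x (I : {fset nat}) :
  (forall i, 0 < x i) -> I != fset0 -> 0 < sumJ x I.
Proof.
move=> x0 /fset0Pn[i iI]; rewrite /sumJ (big_fsetD1 i) //=.
by rewrite addn_gt0 x0.
Qed.

Definition below n (I : {fset nat}) : Prop := forall i, i \in I -> i < n.

Lemma below_notin n I : below n I -> n \notin I.
Proof. by move=> bI; apply/negP => /bI; rewrite ltnn. Qed.

Lemma below0 n : below n fset0.
Proof. by []. Qed.

Lemma below1 n i : i < n -> below n [fset i]%fset.
Proof. by move=> lt_in j; rewrite inE => /eqP ->. Qed.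

Lemma below_maxJ (J : {fset nat}) : below (maxJ J).+1 J.
Proof. by move=> j jJ; rewrite ltnS leq_maxJ. Qed.

Lemma belowS_cases n (I : {fset nat}) : below n.+1 I ->
  below n I \/ exists2 I', below n I' & I = (n |` I')%fset.
Proof.
move=> bI; have [nI|nI] := boolP (n \in I); [right|left].
  exists (I `\ n)%fset; last by rewrite fsetD1K.
  by move=> i; rewrite !inE => /andP[ne iI]; have := bI _ iI; lia.
move=> i iI; have := bI _ iI; rewrite ltnS leq_eqVlt => /orP[/eqP ei|//].
by rewrite -ei iI in nI.
Qed.

Lemma maxJU1 n (I : {fset nat}) : below n I -> maxJ (n |` I)%fset = n.
Proof.
move=> bI; apply: maxJ_unique; first by rewrite !inE eqxx.
by move=> j; rewrite !inE => /orP[/eqP ->//|/bI/ltnW].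
Qed.

Lemma minJU1 n (I : {fset nat}) :
  I != fset0 -> below n I -> minJ (n |` I)%fset = minJ I.
Proof.
move=> I0 bI; apply: minJ_unique; first by rewrite !inE minJ_mem // orbT.
move=> j; rewrite !inE => /orP[/eqP ->|/geq_minJ//].
exact/ltnW/bI/minJ_mem.
Qed.

Lemma minJ1 n : minJ [fset n]%fset = n.
Proof. by apply: minJ_unique => [|j]; rewrite !inE // => /eqP ->. Qed.

Lemma maxJ_split (J : {fset nat}) : J != fset0 ->
  exists I, [/\ below (maxJ J) I, J = (maxJ J |` I)%fset & #|` J| = #|` I|.+1].
Proof.
move=> J0; have [bJ|[I bI eJ]] := belowS_cases (@below_maxJ J).
  by have := bJ _ (maxJ_mem J0); rewrite ltnn.
exists I; split=> //; rewrite {1}eJ cardfsU1 below_notin //.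
Qed.

(** Sums are analysed by their last term; [2 <= k] leaves a nonempty rest, which carries the
    minimum. *)
Lemma ksubset_split k (J : {fset nat}) : 2 <= k -> ksubsets k J ->
  exists I, [/\ below (maxJ J) I, J = (maxJ J |` I)%fset, I != fset0 &
    minJ J = minJ I].
Proof.
move=> k2 Jk; have J0 : J != fset0 by rewrite -cardfs_gt0 Jk ltnW.
have [I [bI eJ cJ]] := maxJ_split J0.
have I0 : I != fset0 by rewrite -cardfs_gt0 -ltnS -cJ Jk.
by exists I; split=> //; rewrite {1}eJ minJU1.
Qed.

(** * Sequences generic for an idempotent ultrafilter *)

Section Ultra.
Variable U : set_system nat.
Context {ultraU : UltraFilter U}.
Hypothesis ooU : \oo `<=` U.
Hypothesis UU : addf U U = U.

Local Notation "'most' z , P" := (U [set z | P])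
  (at level 200, z name, P at level 200).

Lemma mostD (P : nat -> Prop) :
  (most z, P z) = (most x, most y, P (x + y)).
Proof. by rewrite -{1}UU. Qed.

Lemma most_not (P : nat -> Prop) : ~ (most z, P z) -> most z, ~ P z.
Proof. by move=> nP; have [|] := in_ultra_setVsetC P ultraU. Qed.

Lemma most_ex (P : nat -> Prop) : (most z, P z) -> exists z, P z.
Proof. by move=> /filter_ex. Qed.

Lemma most_gt n : most z, n < z.
Proof. by apply: ooU; exists n.+1. Qed.

(** Only finitely many index sets lie below n, and U is closed under finite intersections. *)
Lemma most_below2 n (P : {fset nat} -> {fset nat} -> nat -> Prop) :
  (forall I J, below n I -> below n J -> most z, P I J z) ->
  most z, forall I J, below n I -> below n J -> P I J z.
Proof.
move=> IJP; pose D := fpowerset [fset i in iota 0 n]%fset.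
have inD I : (I \in D) <-> below n I.
  rewrite fpowersetE; split=> [/fsubsetP sI i /sI|bI].
    by rewrite !inE mem_iota.
  by apply/fsubsetP => i /bI; rewrite !inE mem_iota.
have : most z, forall I, I \in D -> forall J, J \in D -> P I J z.
  have big (Q : {fset nat} -> nat -> Prop) :
      (forall I, I \in D -> most z, Q I z) -> most z, forall I, I \in D -> Q I z.
    by move=> DQ; apply: filterS (@filter_bigI _ _ D (fun I => [set z | Q I z])
      U _ DQ) => z Dz I ID; exact: Dz.
  apply: (big (fun I z => forall J, J \in D -> P I J z)) => I /inD bI.
  by apply: big => J /inD bJ; exact: IJP.
by apply: filterS => z Dz I J /inD bI /inD bJ; exact: Dz.
Qed.

(** Greedy choice: A is the set of admissible sums, and R a b constrains the next term in view of
    two earlier sums a and b. Each constraint is U-large and there are finitely many at each stage,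
    so some number satisfies them all. *)
Lemma generic_sequence (A : set nat) (R : nat -> nat -> nat -> Prop) :
  A 0 -> (forall a, A a -> most z, A (a + z)) ->
  (forall a b, A a -> A b -> most z, R a b z) ->
  exists x, [/\ forall n I, below n I -> sumJ x I < x n,
    forall I, A (sumJ x I) &
    forall n I J, below n I -> below n J -> R (sumJ x I) (sumJ x J) (x n)].
Proof.
move=> A0 AD AR.
pose ok s := forall I, below (size s) I -> A (sumJ (nth 0 s) I).
pose good s z := forall I J, below (size s) I -> below (size s) J ->
  [/\ sumJ (nth 0 s) I < z, A (sumJ (nth 0 s) I + z) &
      R (sumJ (nth 0 s) I) (sumJ (nth 0 s) J) z].
(* [next] is total on lists; its value 0 on a list with an inadmissible sum is a dummy, as [oks]
   keeps the construction away from such lists. *)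
have /choice[next nextP] : forall s, exists z, ok s -> good s z.
  move=> s; have [oks|noks] := pselect (ok s); last by exists 0.
  have [z goodz] : exists z, good s z; last by exists z.
  apply/most_ex/most_below2 => I J bI bJ.
  have AI := oks _ bI; have AJ := oks _ bJ.
  apply: filterS (filterI (most_gt (sumJ (nth 0 s) I))
    (filterI (AD _ AI) (AR _ _ AI AJ))).
  by move=> z [? []].
pose s n := iter n (fun s => rcons s (next s)) [::].
pose x n := next (s n).
have sE n : s n = mkseq x n.
  by elim: n => // n IHn; rewrite mkseqS -IHn.
have sumE n I : below n I -> sumJ (nth 0 (s n)) I = sumJ x I.
  by move=> bI; apply: eq_sumJ => i /bI lt_in; rewrite sE nth_mkseq.
have sz n : size (s n) = n by rewrite sE size_mkseq.
have oks n : ok (s n).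
  elim: n => [|n IHn] I; rewrite sz => bI.
    have -> : I = fset0 by apply/fsetP => i; rewrite inE; apply/negP => /bI.
    by rewrite sumJ0.
  have [bI'|[I' bI' ->]] := belowS_cases bI.
    by rewrite (sumE n.+1) // -(sumE n) //; apply: IHn; rewrite sz.
  rewrite (sumE n.+1); last first.
    by move=> i; rewrite !inE => /orP[/eqP->//|/bI'/ltnW].
  rewrite sumJU1 ?below_notin // -(sumE n) //.
  by have [||] := nextP _ IHn I' I'; rewrite ?sz.
exists x; split.
- move=> n I bI; rewrite -(sumE n) //.
  by have [||] := nextP _ (oks n) I I; rewrite ?sz.
- move=> I; have bI := @below_maxJ I; rewrite -(sumE _ _ bI).
  by apply: oks; rewrite sz.
- move=> n I J bI bJ; rewrite -!(sumE n) //.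
  by have [||] := nextP _ (oks n) I J; rewrite ?sz.
Qed.

(** The usual core of a U-large set, from which most shifts do not lead out; 0 is added so that the
    empty sum is admissible. *)
Definition star (G : set nat) : set nat :=
  [set a | a = 0 \/ G a /\ most z, G (a + z)].

Lemma star_shift G a : U G -> star G a -> most z, star G (a + z).
Proof.
move=> UG [->|[Ga UGa]].
  have UGG : most x, most y, G (x + y) by rewrite -mostD.
  by apply: filterS (filterI UG UGG) => z [Gz UGz]; right.
have UGG : most x, most y, G (a + (x + y)).
  by rewrite -(mostD (fun z => G (a + z))).
apply: filterS (filterI UGa UGG) => z [/= Gz UGz]; right; split=> //.
by apply: filterS UGz => y; rewrite /= addnA.
Qed.

Definition shift_rel (E : nat -> nat -> Prop) a b : Prop :=
  most z, E (a + z) (b + z).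

Lemma shift_relK E a b : shift_rel (shift_rel E) a b <-> shift_rel E a b.
Proof.
rewrite /shift_rel (mostD (fun z => E (a + z) (b + z))).
by split; apply: filterS => x; apply: filterS => y /=; rewrite !addnA.
Qed.

Section Relation.
Variable E : nat -> nat -> Prop.
Hypothesis Esym : forall a b, E a b -> E b a.
Hypothesis Etrans : forall a b c, E a b -> E b c -> E a c.

Lemma shift_sym a b : shift_rel E a b -> shift_rel E b a.
Proof. by apply: filterS => z; exact: Esym. Qed.

Lemma shift_trans a b c :
  shift_rel E a b -> shift_rel E b c -> shift_rel E a c.
Proof.
by move=> ab bc; apply: filterS (filterI ab bc) => z [/= ]; exact: Etrans.
Qed.

(* If z |-> a + z had almost constant class c for most a, then most a' + a''  *)
(* would lie in the class c of a', and so would most a' + a'' + y.            *)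
Lemma most_shift_nonconstant : ~ (most x, most y, E (x + y) x) ->
  most a, forall c, most z, ~ E (a + z) c.
Proof.
move=> nE; have: ~ most a, exists c, most z, E (a + z) c.
  move=> Pa; apply: nE; rewrite (mostD (fun x => most y, E (x + y) x)).
  apply: filterS Pa => x /= [c xc].
  have xcc : most y, most z, E (x + (y + z)) c.
    by rewrite -(mostD (fun w => E (x + w) c)).
  apply: filterS (filterI xc xcc) => y [/= Exy]; apply: filterS => z /=.
  by rewrite addnA => Exyz; apply: Etrans Exyz _; exact: Esym.
move=> /most_not; apply: filterS => a na c; apply: most_not => Eac.
by apply: na; exists c.
Qed.

(** If the class of c were U-large, most y and most x + y would lie in it, so x + (y + z) and y + z
    would be related for most z; by idempotence x + w and w would be related for most w. *)
Lemma most_shift_class : ~ (most x, most y, E (x + y) y) ->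
  forall c, most y, ~ shift_rel E y c.
Proof.
move=> nE c; apply: most_not => Ec; apply: nE.
have Ecc : most x, most y, shift_rel E (x + y) c.
  by rewrite -(mostD (fun y => shift_rel E y c)).
apply: filterS Ecc => x /= Ex; rewrite (mostD (fun y => E (x + y) y)).
apply: filterS (filterI Ex Ec) => y [/= xyc yc].
have: shift_rel E (x + y) y by apply: shift_trans xyc _; exact: shift_sym.
by apply: filterS => z; rewrite /= addnA.
Qed.

End Relation.
End Ultra.

(** * Existence of a pattern *)

Definition increasing (x : nat -> nat) : Prop := forall i j, i < j -> x i < x j.

Lemma increasing_inj x : increasing x -> injective x.
Proof.
move=> incx i j eq_x.
by case: (ltngtP i j) => // /incx; rewrite eq_x ltnn.
Qed.

Lemma increasing_ge x : increasing x -> forall i, i <= x i.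
Proof.
by move=> incx; elim=> // i IHi; exact: leq_ltn_trans IHi (incx _ _ (ltnSn i)).
Qed.

Lemma range_infinite_pos x :
  increasing x -> (forall i, 0 < x i) -> infinite_pos (range x).
Proof.
move=> incx x0; split; last by move=> _ [i _ <-]; exact: x0.
have /card_eqPle[_] : (range x #= [set: nat])%card.
  by apply: inj_card_eq => i j _ _; exact: increasing_inj.
by move/infiniteP.
Qed.

Lemma rainbow_range Delta x :
  (forall i j, i < j -> Delta (x j) != Delta (x i)) -> rainbow Delta (range x).
Proof.
move=> xD _ _ [i _ <-] [j _ <-]; case: (ltngtP i j) => [ij _|ji _|->].
- by rewrite eq_sym xD.
- by rewrite xD.
- by rewrite eqxx.
Qed.

Lemma range_or_Xsum k x : 0 < k -> forall a, (range x `|` Xsum k x) a ->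
  exists2 J : {fset nat}, J != fset0 & a = sumJ x J.
Proof.
move=> k0 a [[i _ <-]|[J Jk <-]].
  by exists [fset i]%fset; rewrite ?sumJ1 // -cardfs_gt0 cardfs1.
by exists J => //; rewrite -cardfs_gt0 Jk.
Qed.

Section Canonical.
Variables (k : nat) (Delta : nat -> nat) (U : set_system nat).
Context {ultraU : UltraFilter U}.
Hypothesis k2 : 2 <= k.
Hypothesis ooU : \oo `<=` U.
Hypothesis UU : addf U U = U.

Local Notation "'most' z , P" := (U [set z | P])
  (at level 200, z name, P at level 200).

Let E a b := Delta a = Delta b.
Let Esym a b : E a b -> E b a. Proof. by []. Qed.
Let Etrans a b c : E a b -> E b c -> E a c. Proof. by rewrite /E => ->. Qed.
Let E' := shift_rel U E.
Let E'sym := shift_sym (U := U) Esym.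
Let E'trans := shift_trans (U := U) Etrans.

Let follows_range p := exists x, [/\ increasing x, forall i, 0 < x i &
  follows_enum Delta k p (range x) x].

Lemma superincreasing x : (forall n I, below n I -> sumJ x I < x n) ->
  increasing x /\ forall i, 0 < x i.
Proof.
move=> xgt; split=> [i j ij|i].
  by have := xgt _ _ (below1 ij); rewrite sumJ1.
exact: leq_ltn_trans (leq0n _) (xgt _ _ (@below0 i)).
Qed.

(** The Galvin-Glazer proof of Hindman's theorem: all nonempty sums stay in the core of the color
    class. *)
Lemma generic_mono c : (most z, Delta z = c) -> follows_range Mono.
Proof.
move=> Uc; have sc := star_shift (G := [set z | Delta z = c]) UU.
have [|||x [xgt xA _]] := @generic_sequence U _ ooU
    (star U [set z | Delta z = c]) (fun _ _ _ => True).
- by left.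
- by move=> a; exact: sc.
- by move=> *; apply: filterS filterT.
have [incx x0] := superincreasing xgt.
exists x; split=> // a b.
have xc e : (range x `|` Xsum k x) e -> Delta e = c.
  move=> /(range_or_Xsum (ltnW k2))[J J0 ->].
  by have := sumJ_gt0 x0 J0; case: (xA J) => [->|[]].
by move=> /xc -> /xc ->.
Qed.

Hypothesis nonconst : forall c, most z, ~ Delta z = c.

Lemma generic_max : (most x, most y, E (x + y) y) -> follows_range MaxColored.
Proof.
move=> UM; pose G := [set x | most y, E (x + y) y].
have [|||x [xgt _ xR]] := @generic_sequence U _ ooU (star U G)
    (* The guard excludes the empty sum; taking an earlier term for b makes X rainbow. *)
    (fun a b z => (a <> 0 -> E (a + z) z) /\ Delta z <> Delta b).
- by left.
- by move=> a; exact: star_shift.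
- move=> a b Aa _; apply: filterI; last exact: nonconst.
  case: Aa => [->|[Ga _]]; first by apply: filterS filterT.
  by apply: filterS Ga.
have [incx x0] := superincreasing xgt.
exists x; split=> //; split.
  apply: rainbow_range => i j ij; apply/eqP.
  by have [_] := xR _ _ _ (@below0 j) (below1 ij); rewrite sumJ1.
move=> J /(ksubset_split k2)[I [bI eJ I0 _]].
rewrite {1}eJ sumJU1 ?below_notin //.
have [xE _] := xR _ _ _ bI bI; apply: xE; apply/eqP.
by rewrite -lt0n sumJ_gt0.
Qed.

Lemma generic_min : (most x, most y, E (x + y) x) -> follows_range MinColored.
Proof.
move=> Um; pose G := [set x | most y, E (x + y) x].
have [|||x [xgt _ xR]] := @generic_sequence U _ ooU (star U G)
    (fun a b z => (a <> 0 -> E (a + z) a) /\ Delta z <> Delta b).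
- by left.
- by move=> a; exact: star_shift.
- move=> a b Aa _; apply: filterI; last exact: nonconst.
  case: Aa => [->|[Ga _]]; first by apply: filterS filterT.
  by apply: filterS Ga.
have [incx x0] := superincreasing xgt.
exists x; split=> //; split.
  apply: rainbow_range => i j ij; apply/eqP.
  by have [_] := xR _ _ _ (@below0 j) (below1 ij); rewrite sumJ1.
(* Adding a later term never changes the color of a nonempty sum, so the color goes back to the
   first term. *)
have xmin n J : below n J -> J != fset0 ->
    Delta (sumJ x J) = Delta (x (minJ J)).
  elim: n J => [|n IHn] J bJ J0; first by case/fset0Pn: J0 => j /bJ.
  have [bJ'|[I bI eJ]] := belowS_cases bJ; first exact: IHn.
  have [I0|I0] := eqVneq I fset0.
    by rewrite eJ I0 fsetU0 sumJ1 minJ1.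
  rewrite eJ minJU1 // sumJU1 ?below_notin // -IHn //.
  have [xE _] := xR _ _ _ bI bI; apply: xE; apply/eqP.
  by rewrite -lt0n sumJ_gt0.
move=> J Jk; apply: xmin (@below_maxJ J) _.
by rewrite -cardfs_gt0 Jk ltnW.
Qed.

Hypothesis notM : ~ most x, most y, E (x + y) y.
Hypothesis notm : ~ most x, most y, E (x + y) x.

Let nonconst' c : most y, ~ E' y c.
Proof. exact: (most_shift_class UU Esym Etrans notM). Qed.

Let escape : most a, forall c, most z, ~ E (a + z) c.
Proof. exact: (most_shift_nonconstant UU Esym Etrans notm). Qed.

(** The four conditions on a new term z: a + z avoids all earlier colors, which separates different
    maxima; for a common maximum, equality of colors is [E'] between the rests; each nonempty sum is
    [E']-related to its first term; and distinct terms are not [E']-related. *)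
Lemma generic_minmax : (most x, most y, E' (x + y) x) -> follows_range MinMax.
Proof.
move=> Um; pose G := [set x | most y, E' (x + y) x] `&`
  [set a | forall c, most z, ~ E (a + z) c].
have UG : U G by exact: filterI.
have [|||x [xgt _ xR]] := @generic_sequence U _ ooU (star U G)
    (fun a b z => [/\ Delta (a + z) <> Delta b,
      E' a b <-> Delta (a + z) = Delta (b + z), a <> 0 -> E' (a + z) a &
      ~ E' z b]).
- by left.
- by move=> a; exact: star_shift.
- move=> a b Aa _.
  have U1 : most z, Delta (a + z) <> Delta b.
    by case: Aa => [->|[[_ Ga] _]]; [exact: (nonconst (Delta b))|exact: (Ga b)].
  have U2 : most z, E' a b <-> Delta (a + z) = Delta (b + z).
    have [ab|nab] := pselect (E' a b); last first.
      have Unab : most z, ~ E (a + z) (b + z) by exact: most_not.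
      by apply: filterS Unab => z /= nE.
    have Uab : most z, E (a + z) (b + z) by [].
    by apply: filterS Uab => z /= abz.
  have U3 : most z, a <> 0 -> E' (a + z) a.
    case: Aa => [->|[[Ga _] _]]; first by apply: filterS filterT => z _ [].
    by apply: filterS Ga => z Ez _.
  apply: filterS (filterI (filterI U1 U2) (filterI U3 (nonconst' b))).
  by move=> z [[? ?] [? ?]].
have [incx x0] := superincreasing xgt.
have xneq n I J : below n I -> below n J ->
    Delta (sumJ x I + x n) <> Delta (sumJ x J).
  by move=> bI bJ; have [] := xR _ _ _ bI bJ.
have xmin n J : below n J -> J != fset0 -> E' (sumJ x J) (x (minJ J)).
  elim: n J => [|n IHn] J bJ J0; first by case/fset0Pn: J0 => j /bJ.
  have [bJ'|[I bI eJ]] := belowS_cases bJ; first exact: IHn.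
  have [I0|I0] := eqVneq I fset0.
    by rewrite eJ I0 fsetU0 sumJ1 minJ1; apply: filterS filterT.
  rewrite eJ minJU1 // sumJU1 ?below_notin //; apply: E'trans (IHn _ bI I0).
  have [_ _ xE _] := xR _ _ _ bI bI; apply: xE; apply/eqP.
  by rewrite -lt0n sumJ_gt0.
have xsep i j : E' (x i) (x j) -> i = j.
  have xsep1 m n : m < n -> ~ E' (x n) (x m).
    move=> mn; have [_ _ _] := xR _ _ _ (@below0 n) (below1 mn).
    by rewrite sumJ1.
  case: (ltngtP i j) => // [ij /E'sym|ji].
    by move/(xsep1 _ _ ij).
  by move/(xsep1 _ _ ji).
exists x; split=> //; split.
- apply: rainbow_range => i j ij; apply/eqP.
  by have := xneq _ _ _ (@below0 j) (below1 ij); rewrite sumJ1 sumJ0.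
- rewrite -subset0 => _ [[_ [i _ <-] <-] [_ [J Jk <-] ]].
  have [I [bI eJ I0 _]] := ksubset_split k2 Jk.
  case: (ltngtP i (maxJ J)) => [lt_i|lt_i|->].
  + rewrite eJ sumJU1 ?below_notin // -(sumJ1 x i).
    by apply: xneq => //; exact: below1.
  + move=> /esym; rewrite -[x i]add0n -{1}(sumJ0 x); apply: xneq => // j jJ.
    exact: leq_ltn_trans (leq_maxJ jJ) lt_i.
  (* Here the term is the sum 0 + x n with n = maxJ J, so equal colors would make 0 [E']-related to
     the rest, hence to its first term, against the last condition with b the empty sum. *)
  + rewrite {1}eJ sumJU1 ?below_notin // -[x (maxJ J) in RHS]add0n -(sumJ0 x).
    have [_ <- _ _] := xR _ _ _ bI (@below0 (maxJ J)).
    move=> /E'sym /E'trans /(_ (xmin _ _ bI I0)) /E'sym.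
    have bm : below (minJ I) fset0 by [].
    by have [_ _ _] := xR _ _ _ bm bm.
- move=> I J /(ksubset_split k2)[I' [bI eI I0 mI]].
  move=> /(ksubset_split k2)[J' [bJ eJ J0 mJ]].
  have sub m n L : m < n -> below m L -> below n (m |` L)%fset.
    move=> mn bL j; rewrite !inE => /orP[/eqP ->//|/bL jm].
    exact: ltn_trans jm mn.
  rewrite mI mJ eI eJ !sumJU1 ?below_notin // -?eI -?eJ.
  case: (ltngtP (maxJ I) (maxJ J)) => [lt_IJ|lt_JI|eIJ].
  + split=> [|[_]]; last lia.
    by rewrite -(sumJU1 _ (below_notin bI)) => /xneq; case=> //; exact: sub.
  + split=> [|[_]]; last lia.
    by rewrite -(sumJU1 _ (below_notin bJ)) => /esym/xneq; case=> //; exact: sub.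
  + rewrite -eIJ in bJ *.
    have [_ <- _ _] := xR _ _ _ bJ bI; split=> [JI|[eqm _]].
      split=> //; apply/esym/xsep; apply: E'trans (xmin _ _ bI I0).
      by apply: E'trans JI; apply: E'sym; exact: xmin bJ J0.
    apply: E'trans (xmin _ _ bJ J0) _; rewrite -eqm.
    by apply: E'sym; exact: xmin bI I0.
Qed.

(** The induction separates sums by color and by [E'] at once. When both index sets contain the last
    index, only the [E']-separation of the rests is used, and [shift_relK] makes it reproduce
    itself. *)
Lemma generic_rainbow :
  ~ (most x, most y, E' (x + y) x) -> follows_range Rainbow.
Proof.
move=> notD; have escape' := most_shift_nonconstant UU E'sym E'trans notD.
pose G := [set a | forall c, most z, ~ E (a + z) c] `&`
  [set a | forall c, most z, ~ E' (a + z) c].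
have UG : U G by apply: filterI; [exact: escape|exact: escape'].
have [|||x [xgt _ xR]] := @generic_sequence U _ ooU (star U G)
    (fun a b z => (Delta (a + z) <> Delta b /\ ~ E' (a + z) b) /\
      (~ E' a b -> Delta (a + z) <> Delta (b + z) /\ ~ E' (a + z) (b + z))).
- by left.
- by move=> a; exact: star_shift.
- move=> a b Aa _; apply: filterI.
    case: Aa => [->|[[Ga Ga'] _]]; apply: filterI;
      [exact: (nonconst (Delta b))|exact: nonconst'|exact: (Ga b)|exact: Ga'].
  have [ab|nab] := pselect (E' a b); first by apply: filterS filterT.
  have nab' : ~ shift_rel U E' a b by move/(shift_relK UU).
  apply: filterS (filterI (most_not nab) (most_not nab')).
  by move=> z /= [].
have [incx x0] := superincreasing xgt.
have xneq n I J : below n I -> below n J -> I <> J ->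
    Delta (sumJ x I) <> Delta (sumJ x J) /\ ~ E' (sumJ x I) (sumJ x J).
  elim: n I J => [|n IHn] I J bI bJ nIJ.
    case: nIJ; apply/fsetP => i; apply/idP/idP; first by move/bI.
    by move/bJ.
  have [bI'|[I' bI' eI]] := belowS_cases bI;
    have [bJ'|[J' bJ' eJ]] := belowS_cases bJ.
  - exact: IHn.
  - rewrite eJ sumJU1 ?below_notin //.
    have [[nE nE'] _] := xR _ _ _ bJ' bI'.
    by split; [move/esym|move/E'sym].
  - by rewrite eI sumJU1 ?below_notin //; have [] := xR _ _ _ bI' bJ'.
  - rewrite eI eJ !sumJU1 ?below_notin //.
    have [_] := xR _ _ _ bI' bJ'; apply; apply: (IHn _ _ bI' bJ' _).2.
    by move=> eIJ; apply: nIJ; rewrite eI eJ eIJ.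
exists x; split=> // a b.
move=> /(range_or_Xsum (ltnW k2))[I _ ->].
move=> /(range_or_Xsum (ltnW k2))[J _ ->] nIJ.
apply/eqP; apply: (xneq (maxn (maxJ I) (maxJ J)).+1 I J _ _ _).1.
- by move=> i /leq_maxJ; lia.
- by move=> i /leq_maxJ; lia.
- by move=> eIJ; rewrite eIJ eqxx in nIJ.
Qed.

End Canonical.

Theorem canonical_pattern k Delta : 2 <= k ->
  exists p x, [/\ increasing x, forall i, 0 < x i &
    follows_enum Delta k p (range x) x].
Proof.
move=> k2; have [U ultraU [ooU UU]] := idempotent_ultrafilter.
have [[c Uc]|nc] := pselect (exists c, U [set z | Delta z = c]).
  by exists Mono; exact: generic_mono Uc.
have nonconst c : U [set z | ~ Delta z = c].
  by apply: most_not => Uc; apply: nc; exists c.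
pose E a b := Delta a = Delta b.
have [UM|notM] := pselect (U [set x | U [set y | E (x + y) y]]).
  by exists MaxColored; exact: generic_max UM.
have [Um|notm] := pselect (U [set x | U [set y | E (x + y) x]]).
  by exists MinColored; exact: generic_min Um.
have [UD|notD] := pselect
    (U [set x | U [set y | shift_rel U E (x + y) x]]).
  by exists MinMax; exact: generic_minmax UD.
by exists Rainbow; exact: generic_rainbow notD.
Qed.

(** * Subsequences and pairs *)

Lemma increasing_step x : (forall n, x n < x n.+1) -> increasing x.
Proof.
move=> xS.
exact: (@homo_ltn _ x (fun m n => m < n) (fun _ _ _ => @ltn_trans _ _ _)).
Qed.

Lemma increasing_comp x phi :
  increasing x -> increasing phi -> increasing (x \o phi).
Proof. by move=> incx incphi i j /incphi/incx. Qed.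

Lemma sumJ_comp x phi (J : {fset nat}) : increasing phi ->
  sumJ (x \o phi) J = sumJ x (phi @` J)%fset.
Proof.
move=> incphi; rewrite /sumJ big_imfset //= => i j _ _; exact: increasing_inj.
Qed.

Lemma ksubsets_image k phi (J : {fset nat}) : increasing phi ->
  ksubsets k J -> ksubsets k (phi @` J)%fset.
Proof. by move=> /increasing_inj incphi; rewrite /ksubsets /= card_imfset. Qed.

Lemma increasing_leq phi : increasing phi -> {homo phi : i j / i <= j}.
Proof.
move=> incphi i j; rewrite leq_eqVlt => /predU1P[->//|/incphi].
exact: ltnW.
Qed.

Lemma maxJ_image phi (J : {fset nat}) : increasing phi -> J != fset0 ->
  maxJ (phi @` J)%fset = phi (maxJ J).
Proof.
move=> incphi J0; apply: maxJ_unique; first exact/in_imfset/maxJ_mem.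
by move=> _ /imfsetP[j jJ ->]; apply: increasing_leq => //; exact: leq_maxJ.
Qed.

Lemma minJ_image phi (J : {fset nat}) : increasing phi -> J != fset0 ->
  minJ (phi @` J)%fset = phi (minJ J).
Proof.
move=> incphi J0; apply: minJ_unique; first exact/in_imfset/minJ_mem.
by move=> _ /imfsetP[j jJ ->]; apply: increasing_leq => //; exact: geq_minJ.
Qed.

Lemma rainbow_sub Delta X Y : Y `<=` X -> rainbow Delta X -> rainbow Delta Y.
Proof. by move=> YX rX a b /YX aX /YX; exact: rX. Qed.

Lemma follows_rainbow Delta k p X x :
  p <> Mono -> follows_enum Delta k p X x -> rainbow Delta X.
Proof.
case: p => //= _; first by apply: rainbow_sub => a; left.
- by case.
- by case.
- by case.
Qed.

Lemma Xsum_comp k x phi : increasing phi -> Xsum k (x \o phi) `<=` Xsum k x.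
Proof.
move=> incphi _ [J Jk <-]; exists (phi @` J)%fset; first exact: ksubsets_image.
by rewrite -sumJ_comp.
Qed.

Lemma range_subseq (x phi : nat -> nat) : range (x \o phi) `<=` range x.
Proof. by move=> _ [i _ <-]; exists (phi i). Qed.

(** Patterns are hereditary, so a coloring may be refuted on a well-chosen subsequence. *)
Lemma follows_subsequence Delta k p x phi : 0 < k -> increasing phi ->
  follows_enum Delta k p (range x) x ->
  follows_enum Delta k p (range (x \o phi)) (x \o phi).
Proof.
move=> k0 incphi.
have sub : range (x \o phi) `|` Xsum k (x \o phi) `<=` range x `|` Xsum k x.
  by apply: setUSS; [exact: range_subseq|exact: Xsum_comp].
have Jn0 J : ksubsets k J -> J != fset0.
  by move=> Jk; rewrite -cardfs_gt0 Jk.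
case: p => /=.
- by move=> mX a b /sub Xa /sub; exact: mX.
- exact: rainbow_sub.
- move=> [rX XJ]; split; first by apply: rainbow_sub rX; exact: range_subseq.
  move=> J Jk; rewrite sumJ_comp // XJ ?maxJ_image //; last first.
    exact: ksubsets_image.
  exact: Jn0.
- move=> [rX XJ]; split; first by apply: rainbow_sub rX; exact: range_subseq.
  move=> J Jk; rewrite sumJ_comp // XJ ?minJ_image //; last first.
    exact: ksubsets_image.
  exact: Jn0.
- move=> [rX dX XJ]; split; first by apply: rainbow_sub rX; exact: range_subseq.
    rewrite -subset0 -dX; apply: setISS; apply: image_subset.
      exact: range_subseq.
    exact: Xsum_comp.
  move=> I J Ik Jk; rewrite (sumJ_comp x I) // (sumJ_comp x J) //.
  rewrite XJ; [|exact: ksubsets_image..].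
  rewrite !minJ_image ?maxJ_image //; try exact: Jn0.
  by split=> -[]; [move=> /(increasing_inj incphi) -> /(increasing_inj incphi)
    |move=> -> ->].
Qed.

Lemma enumerates_pos x X : infinite_pos X -> enumerates x X ->
  [/\ increasing x, forall i, 0 < x i & X = range x].
Proof.
move=> [_ posX] [incx eX]; split=> // i.
by apply: posX; rewrite eX; exists i.
Qed.

Lemma ksubset_minJ_lt_maxJ k J : 2 <= k -> ksubsets k J -> minJ J < maxJ J.
Proof.
by move=> k2 /(ksubset_split k2)[I [bI _ I0 ->]]; apply/bI/minJ_mem.
Qed.

Lemma sumJ_gt_max k x J : 2 <= k -> (forall i, 0 < x i) -> ksubsets k J ->
  x (maxJ J) < sumJ x J.
Proof.
move=> k2 x0 /(ksubset_split k2)[I [bI eJ I0 _]].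
rewrite [in ltnRHS]eJ sumJU1 ?below_notin //.
by rewrite -[ltnLHS]add0n ltn_add2r sumJ_gt0.
Qed.

Lemma ksubset2_split L : ksubsets 2 L -> exists2 i, i < maxJ L &
  [/\ L = [fset maxJ L; i]%fset, minJ L = i &
      forall x, sumJ x L = x i + x (maxJ L)].
Proof.
move=> Lk; have [M [bM eL M0 mL]] := ksubset_split (leqnn 2) Lk.
have /eqP/cardfs1P[i eM] : #|` M| = 1.
  by move: Lk; rewrite /ksubsets /= eL cardfsU1 below_notin // => -[].
rewrite eM in bM eL mL; rewrite minJ1 in mL.
exists i; first by apply: bM; rewrite inE.
by split=> // x; rewrite {1}eL sumJU1 ?below_notin // sumJ1.
Qed.

Lemma ksubset2_unique I J : ksubsets 2 I -> ksubsets 2 J ->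
  minJ I = minJ J -> maxJ I = maxJ J -> I = J.
Proof.
move=> /ksubset2_split[i _ [eI mI _]] /ksubset2_split[j _ [eJ mJ _]] emin emax.
by rewrite eI eJ -mI -mJ emin emax.
Qed.

Lemma minmax_pairs Delta X x :
  follows_enum Delta 2 MinMax X x ->
  rainbow Delta (X `|` Xsum 2 x) /\
  (forall I J, ksubsets 2 I -> ksubsets 2 J -> sumJ x I = sumJ x J -> I = J)
    /\ X `&` Xsum 2 x = set0.
Proof.
move=> [rX dX XJ].
have XJ' I J : ksubsets 2 I -> ksubsets 2 J ->
    Delta (sumJ x J) = Delta (sumJ x I) -> I = J.
  by move=> Ik Jk /(XJ _ _ Ik Jk)[]; exact: ksubset2_unique.
have dX' a b : X a -> Xsum 2 x b -> Delta a <> Delta b.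
  move=> Xa Xb eab; rewrite -[False]/((@set0 nat) (Delta a)) -dX.
  by split; [exists a|exists b].
split; last split.
- move=> a b [Xa|Xa] [Xb|Xb].
  + exact: rX.
  + by move=> _; apply/eqP; exact: dX'.
  + by move=> _; apply/eqP => /esym; exact: dX'.
  + case: Xa Xb => I Ik <- [J Jk <-]; apply: contraNneq => /esym/XJ' -> //.
- by move=> I J Ik Jk eIJ; apply: XJ' => //; rewrite eIJ.
- by rewrite -subset0 => a [Xa Xa']; exact: (dX' a a).
Qed.

(** Rainbow speaks of numbers and MinMax of index sets; the two extra hypotheses exclude numbers
    that are represented twice. *)
Lemma rainbow_pairs Delta X x :
  rainbow Delta (X `|` Xsum 2 x) ->
  (forall I J, ksubsets 2 I -> ksubsets 2 J -> sumJ x I = sumJ x J -> I = J) ->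
  X `&` Xsum 2 x = set0 -> follows_enum Delta 2 MinMax X x.
Proof.
move=> rX inj dX; split.
- by apply: rainbow_sub rX => a; left.
- rewrite -subset0 => _ [[a Xa <-] [b Xb]] /eqP eab.
  suff : Delta b != Delta a by rewrite eab.
  apply: rX; [by right|by left|]; apply/eqP => eba.
  by rewrite -[False]/((@set0 nat) a) -dX; split=> //; rewrite -eba.
- move=> I J Ik Jk; split=> [/eqP eIJ|[emin emax]]; last first.
    by rewrite (ksubset2_unique Ik Jk emin emax).
  have [/inj ->//|/eqP nIJ] := pselect (sumJ x I = sumJ x J).
  suff : Delta (sumJ x J) != Delta (sumJ x I) by rewrite eIJ.
  by apply: rX; [right; exists J|right; exists I|rewrite eq_sym].
Qed.

Lemma enumerates_unique x y X : enumerates x X -> enumerates y X -> x = y.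
Proof.
have le u v n : increasing u -> range u = range v -> increasing v ->
    (forall m, m < n -> u m = v m) -> v n <= u n.
  move=> incu euv incv IHn.
  have [j _ ej] : range v (u n) by rewrite -euv; exists n.
  rewrite -ej; apply: increasing_leq => //; rewrite leqNgt; apply/negP => jn.
  move: ej; rewrite -IHn // => /(increasing_inj incu) ej.
  by rewrite ej ltnn in jn.
move=> [incx ex] [incy ey]; apply: funext => n.
elim/ltn_ind: n => n IHn; apply/eqP; rewrite eqn_leq.
have exy : range x = range y by rewrite -ex.
by rewrite !le // => m /IHn.
Qed.

(** The factor 2 puts every pair sum strictly between its larger term and the next term, so that the
    sum determines its maximum. The recursion for [phi] works because x i is at least i. *)
Lemma sparse_subsequence x : increasing x ->
  exists2 phi, increasing phi & forall n, 2 * x (phi n) < x (phi n.+1).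
Proof.
move=> incx; pose phi n := iter n (fun i => (2 * x i).+1) 0.
have phiS n : phi n.+1 = (2 * x (phi n)).+1 by [].
exists phi => [|n]; last by rewrite -phiS; exact: increasing_ge.
apply: increasing_step => n; rewrite phiS.
have := increasing_ge incx (phi n); lia.
Qed.

Lemma sparse_sum_bounds x J : increasing x -> (forall i, 0 < x i) ->
  (forall n, 2 * x n < x n.+1) -> ksubsets 2 J ->
  x (maxJ J) < sumJ x J < x (maxJ J).+1.
Proof.
move=> incx x0 x2 Jk; rewrite (@sumJ_gt_max 2) //=.
have [i lt_i [_ _ ->]] := ksubset2_split Jk.
have := x2 (maxJ J); have := incx _ _ lt_i; lia.
Qed.

Lemma sparse_distinct_sums x : increasing x -> (forall i, 0 < x i) ->
  (forall n, 2 * x n < x n.+1) ->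
  (forall I J, ksubsets 2 I -> ksubsets 2 J -> sumJ x I = sumJ x J -> I = J)
    /\ range x `&` Xsum 2 x = set0.
Proof.
move=> incx x0 x2; have bnd J := @sparse_sum_bounds x J incx x0 x2.
split; last first.
  rewrite -subset0 => _ [[i _ <-] [J Jk eJ]].
  have /andP[lt1 lt2] := bnd _ Jk; rewrite eJ in lt1 lt2.
  have := @increasing_leq x incx i (maxJ J).
  have := @increasing_leq x incx (maxJ J).+1 i; lia.
move=> I J Ik Jk eIJ.
have /andP[lt1 lt2] := bnd _ Ik; have /andP[lt3 lt4] := bnd _ Jk.
rewrite eIJ in lt1 lt2.
have emax : maxJ I = maxJ J.
  have := @increasing_leq x incx (maxJ J).+1 (maxJ I).
  have := @increasing_leq x incx (maxJ I).+1 (maxJ J); lia.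
apply: (ksubset2_unique Ik Jk) => //.
have [i _ [_ -> eI]] := ksubset2_split Ik.
have [j _ [_ -> eJ]] := ksubset2_split Jk.
apply: (increasing_inj incx); move: eIJ; rewrite eI eJ emax; exact: addIn.
Qed.

(** * Colorings that admit only one pattern *)

(** Either some value recurs infinitely often, or f tends to infinity. *)
Lemma constant_or_increasing (f : nat -> nat) : exists2 phi, increasing phi &
  (exists c, forall i, f (phi i) = c) \/ increasing (f \o phi).
Proof.
have [[c fc]|nc] := pselect (exists c, forall n, exists2 i, n < i & f i = c).
  have /choice[g gP] : forall n, exists i, n < i /\ f i = c.
    by move=> n; have [i ? ?] := fc n; exists i.
  exists (fun n => iter n.+1 g 0); last by left; exists c => i; exact: (gP _).2.
  by apply: increasing_step => n; exact: (gP _).1.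
have tail c : exists n, forall i, n < i -> c < f i.
  have neq d : exists n, forall i, n < i -> f i <> d.
    apply: contrapT => nd; apply: nc; exists d => n; apply: contrapT => ni.
    by apply: nd; exists n => i lt_ni fi; apply: ni; exists i.
  elim: c => [|c [n nP]]; first have [n nP] := neq 0; last have [m mP] := neq c.+1.
    by exists n => i /nP; lia.
  by exists (maxn n m) => i lt_i; have := nP i; have := mP i; lia.
have /choice[g gP] : forall n, exists i, n < i /\ f n < f i.
  move=> n; have [m mP] := tail (f n); exists (maxn n m).+1.
  by split; [lia|apply: mP; lia].
exists (fun n => iter n g 0); first by apply: increasing_step => n; exact: (gP _).1.
by right; apply: increasing_step => n; exact: (gP _).2.
Qed.

Lemma logn_add p a b : prime p -> 0 < a -> p ^ (logn p a).+1 %| b ->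
  logn p (a + b) = logn p a.
Proof.
move=> p_pr a0 pb; have ab0 : 0 < a + b by rewrite addn_gt0 a0.
apply/eqP; rewrite eqn_leq; apply/andP; split; last first.
  rewrite -pfactor_dvdn // dvdn_add ?pfactor_dvdnn //.
  by apply: dvdn_trans pb; exact: dvdn_exp2l.
rewrite leqNgt -pfactor_dvdn // dvdn_addl // pfactor_dvdn //.
by rewrite ltnn.
Qed.

(** If the valuations increase, the ultrametric inequality singles out the first term of a sum. If
    they are constantly c, a further thinning makes all residues modulo a high power of p equal, so
    a sum is k times one term up to a multiple of that power, and its valuation is that of k plus
    c. *)
Lemma valuation_subsequence p k x : prime p -> p %| k -> 0 < k ->
  increasing x -> (forall i, 0 < x i) ->
  exists2 phi, increasing phi & let y := x \o phi in
    (forall I J, ksubsets k I -> ksubsets k J -> minJ I = minJ J ->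
      logn p (sumJ y I) = logn p (sumJ y J)) /\
    ((increasing (logn p \o y) /\
      forall J, ksubsets k J -> logn p (sumJ y J) = logn p (y (minJ J))) \/
     exists c, (forall i, logn p (y i) = c) /\
       forall J, ksubsets k J -> c < logn p (sumJ y J)).
Proof.
move=> p_pr pk k0 incx x0.
have [phi incphi] := constant_or_increasing (logn p \o x).
case=> [[c /= xc]|incv]; last first.
  exists phi; [exact: incphi|move=> y].
  have yJ J : ksubsets k J -> logn p (sumJ y J) = logn p (y (minJ J)).
    move=> Jk; have J0 : J != fset0 by rewrite -cardfs_gt0 Jk.
    rewrite /sumJ (big_fsetD1 (minJ J)) ?minJ_mem //=; apply: logn_add => //.
      exact: x0.
    rewrite big_seq; apply: dvdn_sum => j; rewrite !inE => /andP[nj jJ].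
    rewrite pfactor_dvdn //; last exact: x0.
    by apply: incv; rewrite ltn_neqAle eq_sym nj geq_minJ.
  by split=> [I J Ik Jk|]; [rewrite !yJ // => ->|left].
(* One more than the valuation of k times a term, as [logn_add] requires. *)
pose M := (logn p k + c).+1.
have [psi incpsi] := constant_or_increasing (fun i => x (phi i) %% p ^ M).
have pM : 0 < p ^ M by rewrite expn_gt0 prime_gt0.
(* Residues are bounded, so they cannot increase forever. *)
case=> [[r xr]|incr]; last first.
  have /= := increasing_ge incr (p ^ M).
  by rewrite leqNgt ltn_pmod.
have inc := increasing_comp incphi incpsi.
exists (phi \o psi); [exact: inc|set y := x \o (phi \o psi)].
have yJ J : ksubsets k J -> logn p (sumJ y J) = logn p k + c.
  move=> Jk; have y00 : 0 < y 0 by exact: x0.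
  have -> : sumJ y J = k * y 0 + \sum_(j <- J) (y j - y 0).
    have -> : k * y 0 = \sum_(j <- J) y 0.
      by rewrite big_const_seq count_predT iter_addn_0 mulnC Jk.
    rewrite -big_split; apply: eq_bigr => j _ /=; rewrite subnKC //.
    by apply: (increasing_leq (increasing_comp incx inc)).
  have ek : logn p (k * y 0) = logn p k + c.
    by rewrite lognM // /y /= xc.
  rewrite logn_add //; first by rewrite muln_gt0 k0.
  rewrite ek; apply: dvdn_sum => j _; rewrite -eqn_mod_dvd; last first.
    by apply: (increasing_leq (increasing_comp incx inc)).
  by rewrite /y /= !xr.
split=> [I J Ik Jk _|]; first by rewrite !yJ.
right; exists c; split=> [i|J Jk]; first exact: xc.
by rewrite yJ // -[ltnLHS]add0n ltn_add2r logn_gt0 mem_primes p_pr k0.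
Qed.

(** * Sums with equal binary logarithm *)

Fixpoint segment (m n : nat) : {fset nat} :=
  if n is n'.+1 then ((m + n')%N |` segment m n')%fset else fset0.

Lemma below_segment m n : below (m + n) (segment m n).
Proof.
elim: n => //= n IHn i; rewrite !inE => /predU1P[->|/IHn]; lia.
Qed.

Lemma card_segment m n : #|` segment m n| = n.
Proof.
elim: n => //= n IHn; rewrite cardfsU1 IHn below_notin //.
exact: below_segment.
Qed.

Lemma minJ_segment m n : 0 < n -> minJ (segment m n) = m.
Proof.
case: n => // n _; elim: n => [|n IHn]; first by rewrite /= addn0 fsetU0 minJ1.
rewrite [segment _ _]/= -/(segment m n.+1) minJU1 //; last exact: below_segment.
by rewrite -cardfs_gt0 card_segment.
Qed.

Lemma sumJ_segmentS x m n :
  sumJ x (segment m n.+1) = sumJ x (segment m n) + x (m + n).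
Proof. by rewrite sumJU1 // below_notin //; exact: below_segment. Qed.

Lemma sumJ_segment_lt x m n : increasing x -> 0 < n ->
  sumJ x (segment m n) < sumJ x (segment m.+1 n).
Proof.
move=> incx; case: n => // n _; elim: n => [|n IHn].
  by rewrite /= !addn0 !fsetU0 !sumJ1; exact: incx.
rewrite !(sumJ_segmentS _ _ n.+1).
have := incx (m + n.+1) (m.+1 + n.+1); lia.
Qed.

(** Adding x j, larger than all three sums, puts them between x j and 2 * x j, where the logarithm
    takes at most two values; being monotone, it agrees on two consecutive sums. *)
Lemma log_collision x (I : nat -> {fset nat}) : increasing x ->
  (forall i, 0 < x i) -> sumJ x (I 0) < sumJ x (I 1) < sumJ x (I 2) ->
  exists s j, [/\ below j (I s), below j (I s.+1) &
    sumJ x (I s) < sumJ x (I s.+1) /\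
    trunc_log 2 (sumJ x (j |` I s)%fset) =
    trunc_log 2 (sumJ x (j |` I s.+1)%fset)].
Proof.
move=> incx x0 /andP[lt01 lt12].
pose j := (maxn (sumJ x (I 2))
  (maxn (maxJ (I 0)) (maxn (maxJ (I 1)) (maxJ (I 2))))).+1.
have bI s : s < 3 -> below j (I s).
  by move=> s3 i /leq_maxJ; rewrite /j; case: s s3 => [|[|[|]]] // _; lia.
have sumE s : s < 3 -> sumJ x (j |` I s)%fset = sumJ x (I s) + x j.
  by move=> s3; apply/sumJU1/below_notin/bI.
have lt2 : sumJ x (I 2) < x j by have := increasing_ge incx j; rewrite /j; lia.
have le2 : trunc_log 2 (sumJ x (j |` I 2)%fset) <=
    (trunc_log 2 (sumJ x (j |` I 0)%fset)).+1.
  rewrite -trunc_log2_double; last by rewrite sumE //; have := x0 j; lia.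
  by apply: leq_trunc_log; rewrite !sumE //; lia.
have le s : s < 2 -> sumJ x (I s) < sumJ x (I s.+1) ->
    trunc_log 2 (sumJ x (j |` I s)%fset) <=
    trunc_log 2 (sumJ x (j |` I s.+1)%fset).
  by move=> s2 lts; apply: leq_trunc_log; rewrite !sumE //; lia.
have [e01|n01] := eqVneq (trunc_log 2 (sumJ x (j |` I 0)%fset))
    (trunc_log 2 (sumJ x (j |` I 1)%fset)).
  by exists 0, j; split; [exact: bI..|split].
exists 1, j; split; [exact: bI..|split=> //].
have := le 0 isT lt01; have := le 1 isT lt12; lia.
Qed.

Lemma trunc_log_unbounded x N : increasing x -> exists2 i, N <= i &
  forall a, x i <= a -> N < trunc_log 2 a.
Proof.
move=> incx; exists (2 ^ N.+1); first by have := ltn_expl N.+1 (isT : 1 < 2); lia.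
move=> a xa; apply: trunc_log_max => //.
exact: leq_trans (increasing_ge incx _) xa.
Qed.

(** * Excluding the other patterns for each special coloring *)

Section Obstructions.
Variables (k : nat) (x : nat -> nat).
Hypothesis k2 : 2 <= k.
Hypothesis incx : increasing x.
Hypothesis x0 : forall i, 0 < x i.

Lemma ksubset_initial j : k.-1 <= j -> ksubsets k (j |` segment 0 k.-1)%fset.
Proof.
move=> kj; rewrite /ksubsets /= cardfsU1 card_segment.
have -> : j \notin segment 0 k.-1.
  by apply/negP => /below_segment; lia.
by rewrite add1n prednK // ltnW.
Qed.

Lemma minJ_initial j : k.-1 <= j -> minJ (j |` segment 0 k.-1)%fset = 0.
Proof.
move=> kj; have k1 : 0 < k.-1 by lia.
rewrite minJU1 ?minJ_segment // -?cardfs_gt0 ?card_segment //.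
by move=> i /below_segment; lia.
Qed.

Lemma sumJ_initial j : k.-1 <= j ->
  sumJ x (j |` segment 0 k.-1)%fset = sumJ x (segment 0 k.-1) + x j.
Proof. by move=> kj; rewrite sumJU1 //; apply/negP => /below_segment; lia. Qed.

(* Adding a common maximum to the prongs gives k-subsets that, for k >= 3,    *)
(* share their minimum as well.                                               *)
Let prong s : {fset nat} := ((k.-2 + s)%N |` segment 0 k.-2)%fset.

Let prong_notin s : (k.-2 + s)%N \notin segment 0 k.-2.
Proof. by apply/negP => /below_segment; lia. Qed.

Lemma below_prong s : s < 3 -> below k.+1 (prong s).
Proof. by move=> s3 i; rewrite !inE => /predU1P[->|/below_segment]; lia. Qed.

Lemma sumJ_prong s : sumJ x (prong s) = sumJ x (segment 0 k.-2) + x (k.-2 + s).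
Proof. by rewrite sumJU1. Qed.

Lemma ksubset_prong s j : below j (prong s) -> ksubsets k (j |` prong s)%fset.
Proof.
move=> bj; rewrite /ksubsets /= !cardfsU1 card_segment prong_notin.
rewrite below_notin //; lia.
Qed.

Lemma minJ_prong s j : 3 <= k -> below j (prong s) ->
  minJ (j |` prong s)%fset = 0.
Proof.
move=> k3 bj; rewrite minJU1 //; last first.
  by apply/fset0Pn; exists (k.-2 + s); rewrite !inE eqxx.
rewrite minJU1; first by rewrite minJ_segment; lia.
  by rewrite -cardfs_gt0 card_segment; lia.
by move=> i /below_segment; lia.
Qed.

Lemma constant_obstruction q :
  q <> Mono -> ~ follows_enum (fun=> 1) k q (range x) x.
Proof.
move=> qM /(follows_rainbow qM) /(_ (x 0) (x 1)).
have := incx (isT : 0 < 1); case: eqVneq => [->|_ _ r]; first by rewrite ltnn.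
by have := r (ex_intro2 _ _ 0 I erefl) (ex_intro2 _ _ 1 I erefl) isT.
Qed.

(** A sum exceeds each of its terms, and for 3 <= k MinMax would identify two sums that differ in a
    middle term. *)
Lemma identity_obstruction q :
  q <> Rainbow -> ~ (k = 2 /\ q = MinMax) ->
  ~ follows_enum (fun n => n) k q (range x) x.
Proof.
case: q => //= _ kq.
- move=> m; have := incx (isT : 0 < 1).
  by rewrite (m (x 0) (x 1)) ?ltnn //; left; [exists 0|exists 1].
- move=> [_ /(_ _ (ksubset_initial (leqnn _)))].
  by have := sumJ_gt_max k2 x0 (ksubset_initial (leqnn _)); lia.
- move=> [_ /(_ _ (ksubset_initial (leqnn _)))].
  have := sumJ_gt_max k2 x0 (ksubset_initial (leqnn _)).
  have := incx (ksubset_minJ_lt_maxJ k2 (ksubset_initial (leqnn _))); lia.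
- have k3 : 3 <= k by case: (ltngtP k 2) => // [|k_2]; [lia|case: kq].
  have bc n : n < 3 -> below k.+1 (prong n) by exact: below_prong.
  move=> [_ _ /(_ _ _ (ksubset_prong (bc 0 isT)) (ksubset_prong (bc 1 isT)))].
  rewrite !maxJU1; [|exact: bc..]; rewrite !minJ_prong //; [|exact: bc..].
  rewrite (sumJU1 x (below_notin (bc 0 isT))).
  rewrite (sumJU1 x (below_notin (bc 1 isT))).
  move=> [_ /(_ (conj erefl erefl))]; rewrite !sumJ_prong.
  have := incx (_ : k.-2 + 0 < k.-2 + 1); lia.
Qed.

Lemma log_mono_obstruction c : ~ forall i, trunc_log 2 (x i) = c.
Proof.
move=> xc; have [i _ /(_ _ (leqnn _))] := trunc_log_unbounded c incx.
by rewrite xc ltnn.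
Qed.

(** The minimum stays at index 0 while the last term, and with it the logarithm of the sum, grows
    without bound. *)
Lemma log_min_obstruction :
  ~ forall J, ksubsets k J -> trunc_log 2 (sumJ x J) = trunc_log 2 (x (minJ J)).
Proof.
have [i Ni iP] := trunc_log_unbounded (maxn k (trunc_log 2 (x 0))) incx.
have ki : k.-1 <= i by lia.
move=> /(_ _ (ksubset_initial ki)); rewrite minJ_initial // sumJ_initial //.
by have := iP _ (leq_addl (sumJ x (segment 0 k.-1)) (x i)); lia.
Qed.

Lemma log_collision_same_min : 3 <= k -> exists I J,
  [/\ ksubsets k I, ksubsets k J, minJ I = minJ J, sumJ x I <> sumJ x J &
      trunc_log 2 (sumJ x I) = trunc_log 2 (sumJ x J)].
Proof.
move=> k3.
have [|s [j [bs bs1 [lt_s es]]]] := @log_collision x prong incx x0.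
  rewrite !sumJ_prong; have := incx (_ : k.-2 + 0 < k.-2 + 1).
  have := incx (_ : k.-2 + 1 < k.-2 + 2); lia.
exists (j |` prong s)%fset, (j |` prong s.+1)%fset; split=> //.
- exact: ksubset_prong.
- exact: ksubset_prong.
- by rewrite !minJ_prong.
- rewrite (sumJU1 x (below_notin bs)) (sumJU1 x (below_notin bs1)); lia.
Qed.

Lemma log_obstruction q : q <> MaxColored ->
  ~ follows_enum (fun n => (trunc_log 2 n).+1) k q (range x) x.
Proof.
(* Shifted segments completed by a common maximum: their distinct sums refute Rainbow and their
   distinct minima refute MinMax. *)
have coll : exists I J, [/\ ksubsets k I, ksubsets k J, minJ I <> minJ J,
    sumJ x I <> sumJ x J & trunc_log 2 (sumJ x I) = trunc_log 2 (sumJ x J)].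
  have k1 : 0 < k.-1 by lia.
  have [|s [j [bs bs1 [lt_s es]]]] :=
      @log_collision x (fun m => segment m k.-1) incx x0.
    by rewrite !sumJ_segment_lt.
  have jk m : below j (segment m k.-1) -> ksubsets k (j |` segment m k.-1)%fset.
    move=> bm; rewrite /ksubsets /= cardfsU1 card_segment below_notin //.
    by rewrite add1n prednK // ltnW.
  have m0 m : segment m k.-1 != fset0 by rewrite -cardfs_gt0 card_segment.
  exists (j |` segment s k.-1)%fset, (j |` segment s.+1 k.-1)%fset; split=> //.
  - exact: jk.
  - exact: jk.
  - by rewrite !minJU1 // !minJ_segment //; lia.
  - by rewrite !sumJU1 ?below_notin //; lia.
have [I [J [Ik Jk nm ns eIJ]]] := coll.
case: q => //= _.
- move=> m; apply: (@log_mono_obstruction (trunc_log 2 (x 0))) => i.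
  by apply: succn_inj; apply: m; left; [exists i|exists 0].
- move=> /(_ (sumJ x I) (sumJ x J)); rewrite eIJ eqxx => r.
  suff: false by [].
  by apply: r; [right; exists I|right; exists J|apply/eqP].
- move=> [_ mc]; apply: log_min_obstruction => L /mc; exact: succn_inj.
- by move=> [_ _ /(_ _ _ Ik Jk)]; rewrite eIJ => -[/(_ erefl)[]].
Qed.

End Obstructions.

Lemma rainbow_neq Delta Y a b : rainbow Delta Y -> Y a -> Y b ->
  Delta a = Delta b -> a = b.
Proof.
by move=> rY Ya Yb eab; apply/eqP; apply: contraPT (eab) => /(rY _ _ Ya Yb)/eqP.
Qed.

(** With constant valuations X is not rainbow and Mono fails on the sums. With increasing ones a sum
    has the color of its first term, against MaxColored and MinMax; two sums with the same first
    term refute Rainbow. *)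
Lemma valuation_obstruction k p x q : 2 <= k -> prime p -> p %| k ->
  increasing x -> (forall i, 0 < x i) -> q <> MinColored ->
  ~ follows_enum (fun n => (logn p n).+1) k q (range x) x.
Proof.
move=> k2 p_pr pk incx x0 qm; have k0 := ltnW k2.
have [phi incphi] := valuation_subsequence p_pr pk k0 incx x0.
set y := x \o phi => -[ymin yv].
move=> /(follows_subsequence k0 incphi); rewrite -/y => fy.
have incy : increasing y := increasing_comp incx incphi.
have Ik := ksubset_initial k2 (leqnn k.-1).
have Jk := ksubset_initial k2 (leqnSn k.-1).
case: yv => [[incv yJ]|[c [yc yJ]]]; last first.
  have [qM|qM] := pselect (q = Mono); last first.
    have /= := rainbow_neq (follows_rainbow qM fy) (ex_intro2 _ _ 0 I erefl)
      (ex_intro2 _ _ 1 I erefl).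
    by rewrite !yc => /(_ erefl) /(increasing_inj incy).
  rewrite qM /= in fy.
  have := fy (y 0) _ (or_introl (ex_intro2 _ _ 0 I erefl))
    (or_intror (ex_intro2 _ _ _ Ik erefl)).
  by have := yJ _ Ik; rewrite yc; lia.
case: q qm fy => //= _.
- move=> m; have := incv 0 1 isT => /=.
  have := m (y 0) (y 1) (or_introl (ex_intro2 _ _ 0 I erefl))
    (or_introl (ex_intro2 _ _ 1 I erefl)); lia.
- move=> r; have := rainbow_neq r (or_intror (ex_intro2 _ _ _ Ik erefl))
    (or_intror (ex_intro2 _ _ _ Jk erefl)).
  rewrite !yJ // !minJ_initial //.
  rewrite !sumJ_initial // => /(_ erefl) /addnI/(increasing_inj incy); lia.
- move=> [_ /(_ _ Ik)]; rewrite yJ // => -[].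
  have := incv _ _ (ksubset_minJ_lt_maxJ k2 Ik) => /=; lia.
- move=> [_ d _]; set J := (k.-1 |` segment 0 k.-1)%fset in Ik.
  rewrite -[False]/((@set0 nat) (logn p (y (minJ J))).+1) -d.
  split; first by exists (y (minJ J)) => //; exists (minJ J).
  by exists (sumJ y J); [exists J|rewrite yJ].
Qed.

(** [pickle] codes the pair injectively; the successor makes the color positive. *)
Definition valuation_log p n := (choice.pickle (logn p n, trunc_log 2 n)).+1.

Lemma valuation_log_inj p m n : valuation_log p m = valuation_log p n ->
  logn p m = logn p n /\ trunc_log 2 m = trunc_log 2 n.
Proof. by move=> /succn_inj/(pcan_inj choice.pickleK) [-> ->]. Qed.

(** The logarithm refutes Mono and MinColored, the valuation refutes MaxColored. For 3 <= k, sums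
    with equal minimum and equal logarithm also agree in valuation on the subsequence, against
    Rainbow. *)
Lemma valuation_log_obstruction k p x q : 2 <= k -> prime p -> p %| k ->
  increasing x -> (forall i, 0 < x i) ->
  q <> MinMax -> ~ (k = 2 /\ q = Rainbow) ->
  ~ follows_enum (valuation_log p) k q (range x) x.
Proof.
move=> k2 p_pr pk incx x0 qm kq; have k0 := ltnW k2.
have [phi incphi] := valuation_subsequence p_pr pk k0 incx x0.
set y := x \o phi => -[ymin yv].
move=> /(follows_subsequence k0 incphi); rewrite -/y => fy.
have incy : increasing y := increasing_comp incx incphi.
have y0 i : 0 < y i by exact: x0.
case: q qm kq fy => //= _ kq.
- move=> m; apply: (@log_mono_obstruction _ incy (trunc_log 2 (y 0))) => i.
  by apply: (valuation_log_inj (m _ _ _ _)).2; left; [exists i|exists 0].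
- move=> r; have k3 : 3 <= k by case: (ltngtP k 2) => // [|k_2]; [lia|case: kq].
  have [I [J [Ik Jk mIJ sIJ lIJ]]] := log_collision_same_min k2 incy y0 k3.
  apply: sIJ; apply: (rainbow_neq r); [by right; exists I|by right; exists J|].
  by rewrite /valuation_log lIJ (ymin I J).
- have Ik := ksubset_initial k2 (leqnn k.-1).
  move=> [_ /(_ _ Ik) /valuation_log_inj[+ _]].
  case: yv => [[incv yJ]|[c [yc /(_ _ Ik)]]]; last by rewrite yc; lia.
  by rewrite yJ //; have := incv _ _ (ksubset_minJ_lt_maxJ k2 Ik) => /=; lia.
- move=> [_ mc]; apply: (log_min_obstruction k2 incy) => J /mc.
  by case/valuation_log_inj.
Qed.

Theorem theorem3p1 (k : nat) (hk : 2 <= k) :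
  (forall Delta : nat -> nat, coloring Delta ->
     exists X : set nat, infinite_pos X /\
       (follows Delta k Mono X \/
        follows Delta k Rainbow X \/
        follows Delta k MaxColored X \/
        follows Delta k MinColored X \/
        follows Delta k MinMax X))
  /\
  (k = 2 -> forall Delta : nat -> nat, coloring Delta ->
     forall X : set nat, infinite_pos X ->
       (follows Delta k MinMax X <->
        follows Delta k Rainbow X /\ distinct_sums k X)
       /\
       (follows Delta k Rainbow X ->
        exists Y : set nat,
          [/\ infinite_pos Y, Y `<=` X & follows Delta k MinMax Y]))
  /\
  (forall p : pattern, exists Delta : nat -> nat, coloring Delta /\
     forall X : set nat, infinite_pos X ->
       forall q : pattern, ~ same_pattern k p q -> ~ follows Delta k q X).
Proof.
split; [|split].
- move=> Delta _; have [p [x [incx x0 xp]]] := canonical_pattern Delta hk.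
  exists (range x); split; first exact: range_infinite_pos.
  have: follows Delta k p (range x) by exists x.
  by case: p xp => _ fol; tauto.
- move=> k2 Delta _ X posX; rewrite k2; split; first split.
  + move=> [x enumx /minmax_pairs[r d]].
    by split; exists x.
  + move=> [[x enumx r] [y enumy]].
    rewrite -(enumerates_unique enumx enumy) => -[inj d].
    by exists x => //; exact: rainbow_pairs.
  + move=> [x enumx r]; have [incx x0 eX] := enumerates_pos posX enumx.
    have [phi incphi x2] := sparse_subsequence incx.
    have incy := increasing_comp incx incphi.
    have y0 i : 0 < (x \o phi) i by exact: x0.
    have [inj d] := sparse_distinct_sums incy y0 x2.
    exists (range (x \o phi)); split; first exact: range_infinite_pos.
      by rewrite eX; exact: range_subseq.
    exists (x \o phi) => //; apply: rainbow_pairs => //.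
    rewrite eX in r; exact: (@follows_subsequence Delta 2 Rainbow).
- have p_pr := pdiv_prime hk; have pk := pdiv_dvd k.
  case.
  + exists (fun=> 1); split=> // X posX q nq [x /(enumerates_pos posX)[incx x0 ->]].
    by apply: constant_obstruction => // eq; apply: nq; left.
  + exists id; split=> // X posX q nq [x /(enumerates_pos posX)[incx x0 ->]].
    apply: identity_obstruction => // [eq|[k2 eq]]; apply: nq; [by left|right].
    by split=> //; left.
  + exists (fun n => (trunc_log 2 n).+1); split=> // X posX q nq.
    move=> [x /(enumerates_pos posX)[incx x0 ->]].
    by apply: log_obstruction => // eq; apply: nq; left.
  + exists (fun n => (logn (pdiv k) n).+1); split=> // X posX q nq.
    move=> [x /(enumerates_pos posX)[incx x0 ->]].
    by apply: valuation_obstruction => // eq; apply: nq; left.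
  + exists (valuation_log (pdiv k)); split=> // X posX q nq.
    move=> [x /(enumerates_pos posX)[incx x0 ->]].
    apply: valuation_log_obstruction => // [eq|[k2 eq]]; apply: nq; [by left|right].
    by split=> //; right.
Qed.
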